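(* Let $k\ge2$. Let $P_1,\ldots,P_k$ be uniformly L-bounded posets with $\hat 0$, such that $e_1\ge\cdots\ge e_k$, where $e_i=e(P_i)$. Then the wedge $P=\mathcal V(P_1,\ldots,P_k)$ is lower-L-bounded. In addition, if $e_1>e_2$, then $P$ is L-bounded.
   Context: All posets are finite and nonempty. Let $[n]=\{1,\dots,n\}$; families of subsets of $[n]$ are ordered by inclusion. A poset $(P,\le)$ contains a poset $(P',\le')$ as a (weak) subposet if there is an injection $f:P'\to P$ such that $u\le' v$ implies $f(u)\le f(v)$. A family $\mathcal F\subseteq 2^{[n]}$ is $P$-free if it does not contain $P$ in this sense. $e(P)$ is the maximum integer $k\ge 0$ such that for all integers $n$ and $s$ the family $\binom{[n]}{s}\cup\binom{[n]}{s+1}\cup\cdots\cup\binom{[n]}{s+k-1}$ is $P$-free, where $\binom{[n]}{j}$ is the collection of $j$-element subsets of $[n]$ (empty if $j<0$ or $j>n$). The Lubell function of $\mathcal F\subseteq 2^{[n]}$ is the average over all $n!$ full (maximal) chains $\mathcal C$ of $2^{[n]}$ of $|\mathcal F\cap\mathcal C|$; equivalently $\bar h_n(\mathcal F)=\sum_{F\in\mathcal F}1/\binom{n}{|F|}$. For an integer $m\ge0$, $P$ is $m$-L-bounded if for all $n$, $\bar h_n(\mathcal F)\le e(P)$ for every $P$-free family $\mathcal F$ of subsets of $[n]$ all of whose members have sizes in $[m,n-m]$. $P$ is uniformly L-bounded if it is $0$-L-bounded, and L-bounded if it is $m$-L-bounded for some integer $m\ge 0$. $P$ is lower-L-bounded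 if for any $\beta\in(\frac12,1)$ and $\varepsilon>0$ there exists $N=N(\beta,\varepsilon)$ such that for all $n\ge N$, $\bar h_n(\mathcal F)\le e(P)+\varepsilon$ for all $P$-free families $\mathcal F$ of subsets of $[n]$ of sizes less than $\beta n$. An element $x$ of a poset $P$ is $\hat 0$ if $x\le p$ for all $p\in P$. For posets $P_1,\dots,P_k$ with $\hat 0$, the wedge $\mathcal V(P_1,\ldots,P_k)$ is the poset obtained from their disjoint union by identifying the $\hat 0$'s of the posets (elements of different $P_i$ other than the common $\hat 0$ are incomparable). *)

(* Defs.v *)
From HB Require Import structures.
From mathcomp Require Import all_boot all_order all_fingroup all_algebra.
From mathcomp Require Import boolp reals.

Set Implicit Arguments.
Unset Strict Implicit.
Unset Printing Implicit Defensive.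

Import Order.TTheory GRing.Theory Num.Theory.
Local Open Scope ring_scope.

(* Weak containment: incomparable elements of P may have comparable images. *)
Definition contains_poset (d : Order.disp_t) (P : finPOrderType d) (n : nat)
    (F : {set {set 'I_n}}) : Prop :=
  exists f : P -> {set 'I_n},
    [/\ injective f, forall u, f u \in F &
        forall u v : P, (u <= v)%O -> f u \subset f v].

Definition poset_free (d : Order.disp_t) (P : finPOrderType d) (n : nat)
    (F : {set {set 'I_n}}) : Prop :=
  ~ contains_poset P F.

(* Levels s, s + 1, ..., s + k - 1; levels outside [0, n] are empty. *)
Definition consecutive_levels (n : nat) (s : int) (k : nat) :
    {set {set 'I_n}} :=
  [set A : {set 'I_n} | (s <= #|A|%:Z) && (#|A|%:Z < s + k%:Z)].

Definition levels_free (d : Order.disp_t) (P : finPOrderType d) (k : nat) :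
    Prop :=
  forall (n : nat) (s : int), poset_free P (consecutive_levels n s k).

(* The bound #|P| on the range of k loses nothing, see [levels_free_card]. *)
Definition e_poset (d : Order.disp_t) (P : finPOrderType d) : nat :=
  (\max_(k < #|P|.+1 | `[< levels_free P k >]) k)%N.

Lemma levels_free_card (d : Order.disp_t) (P : finPOrderType d) (k : nat) :
  levels_free P k -> (k <= #|P|)%N.
Proof.
move=> freeP; rewrite leqNgt; apply/negP => ltPk.
apply: (freeP #|P| 0); exists (fun x => [set enum_rank y | y in <= x]%O).
split=> [x y Exy|x|x y lexy].
- have in_down (u v : P) :
      (enum_rank u \in [set enum_rank w | w in <= v]%O) = (u <= v)%O.
    by rewrite (mem_imset _ _ enum_rank_inj) inE.
  have same u : (u <= x)%O = (u <= y)%O by rewrite -!in_down Exy.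
  by apply: le_anti; rewrite -same lexx same lexx.
- rewrite inE add0r lez_nat ltz_nat leq0n /=.
  by apply: leq_ltn_trans ltPk; rewrite -[leqRHS]card_ord max_card.
- apply/subsetP => _ /imsetP[w lewx ->]; apply: imset_f.
  by move: lewx; rewrite !inE => /le_trans; apply.
Qed.

Lemma e_posetP (d : Order.disp_t) (P : finPOrderType d) :
    (0 < #|P|)%N ->
  levels_free P (e_poset P) /\
  forall k, levels_free P k -> (k <= e_poset P)%N.
Proof.
move=> /card_gt0P[x0 _]; split=> [|k freek]; last first.
  have ltk : (k < #|P|.+1)%N by rewrite ltnS levels_free_card.
  by rewrite -[k]/(val (Ordinal ltk)); apply: leq_bigmax_cond; apply/asboolP.
have free0 : levels_free P (@ord0 #|P|).
  move=> n s [f [_ /(_ x0) + _]]; rewrite inE addr0 => /andP[le1 lt1].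
  by have := le_lt_trans le1 lt1; rewrite ltxx.
rewrite /e_poset (@bigop.bigmax_eq_arg _ ord0) ?asboolE //.
by case: arg_maxnP => [|i /asboolP freei _] //; rewrite asboolE.
Qed.

Definition is_chain (n : nat) (C : {set {set 'I_n}}) : bool :=
  [forall A in C, forall B in C, (A \subset B) || (B \subset A)].

Definition full_chains (n : nat) : {set {set {set 'I_n}}} :=
  [set C | maxset (@is_chain n) C].

Definition lubell (R : realType) (n : nat) (F : {set {set 'I_n}}) : R :=
  (\sum_(C in full_chains n) #|F :&: C|%:R) / #|full_chains n|%:R.

Section LubellFormula.
Variable n : nat.
Implicit Types (A B D : {set 'I_n}) (C E : {set {set 'I_n}}).

Let is_chainP C :
  reflect {in C &, forall A B, (A \subset B) || (B \subset A)} (is_chain C).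
Proof.
apply: (iffP forall_inP) => [chC A B CA CB|chC A CA].
  by have /forall_inP := chC A CA; apply.
by apply/forall_inP => B CB; apply: chC.
Qed.

Let comparable_full C D : C \in full_chains n ->
  (forall A, A \in C -> (A \subset D) || (D \subset A)) -> D \in C.
Proof.
rewrite inE => /maxsetP[/is_chainP chC maxC] compD.
rewrite -(maxC (D |: C)) ?setU11 ?subsetUr //; apply/is_chainP => A B.
rewrite !in_setU1 => /predU1P[->|CA] /predU1P[->|CB].
- by rewrite subxx.
- by rewrite orbC compD.
- exact: compD.
- exact: chC.
Qed.

Let level_full C k : C \in full_chains n -> (k <= n)%N ->
  #|[set A in C | #|A| == k]| = 1%N.
Proof.
move=> fullC lekn.
have /is_chainP chC : is_chain C by move: fullC; rewrite inE => /maxsetp.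
have C0 : set0 \in C.
  by apply: comparable_full => // A _; rewrite sub0set orbT.
have CT : setT \in C by apply: comparable_full => // A _; rewrite subsetT.
have cardle A B : A \in C -> B \in C -> (#|A| <= #|B|)%N -> A \subset B.
  move=> CA CB leAB; case/orP: (chC A B CA CB) => // sBA.
  by have /eqP-> : B == A by rewrite eqEcard sBA.
apply/eqP; rewrite eqn_leq; apply/andP; split.
  apply/card_le1_eqP => A B; rewrite !inE => /andP[CA /eqP cA] /andP[CB /eqP cB].
  by apply/eqP; rewrite eqEsubset !cardle ?cA ?cB.
pose low A := (A \in C) && (#|A| <= k)%N; pose high A := (A \in C) && (k <= #|A|)%N.
have low0 : low set0 by rewrite /low C0 cards0.
have highT : high setT by rewrite /high CT cardsT card_ord.
case: (arg_maxnP (fun A : {set 'I_n} => #|A|) low0) => B /andP[CB leBk] maxB.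
case: (arg_minnP (fun A : {set 'I_n} => #|A|) highT) => D /andP[CD lekD] minD.
have sBD : B \subset D by rewrite cardle // (leq_trans leBk).
have [X sXD cX] : exists2 X : {set 'I_n}, X \subset D :\: B & #|X| = (k - #|B|)%N.
  have : (0 < #|[set X : {set 'I_n} | X \subset D :\: B & #|X| == (k - #|B|)%N]|)%N.
    by rewrite cards_draws bin_gt0 cardsDS // leq_sub2r.
  by case/card_gt0P => X; rewrite inE => /andP[sX /eqP cX]; exists X.
have cBX : #|B :|: X| = k.
  rewrite cardsU cX disjoint_setI0 ?cards0 ?subn0 ?subnKC //.
  by rewrite disjoint_sym; move: sXD; rewrite subsetD => /andP[].
apply/card_gt0P; exists (B :|: X); rewrite inE cBX eqxx andbT.
apply: comparable_full => // A CA; case: (leqP #|A| k) => [leAk|/ltnW lekA].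
  by rewrite (subset_trans _ (subsetUl B X)) // cardle //; apply: maxB; rewrite /low CA.
rewrite orbC (subset_trans _ (_ : D \subset A)) //.
  by rewrite subUset sBD (subset_trans sXD) // subsetDl.
by rewrite cardle //; apply: minD; rewrite /high CA.
Qed.

Let chains_through A : {set {set {set 'I_n}}} := [set C in full_chains n | A \in C].

Let act (p : {perm 'I_n}) C : {set {set 'I_n}} := [set p @: (A : {set 'I_n}) | A in C].

Let actK p : cancel (act p) (act p^-1%g).
Proof.
move=> C; rewrite /act -imset_comp -[RHS]imset_id; apply: eq_imset => A /=.
by rewrite -imset_comp -[RHS]imset_id; apply: eq_imset => x /=; rewrite permK.
Qed.

Let act_chain p C : is_chain C -> is_chain (act p C).
Proof.
move=> /is_chainP chC; apply/is_chainP => _ _ /imsetP[A CA ->] /imsetP[B CB ->].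
by case/orP: (chC A B CA CB) => /imsetS->; rewrite ?orbT.
Qed.

Let act_full p C : C \in full_chains n -> act p C \in full_chains n.
Proof.
rewrite !inE => /maxsetP[chC maxC]; apply/maxsetP; split; first exact: act_chain.
move=> E chE sCE; rewrite -(maxC (act p^-1%g E)); last first.
- by rewrite -{1}(actK p C); apply: imsetS.
- exact: act_chain.
by have := actK p^-1%g E; rewrite invgK.
Qed.

Let card_through_perm (p : {perm 'I_n}) A :
  (#|chains_through A| <= #|chains_through (p @: A)|)%N.
Proof.
rewrite -(card_imset _ (can_inj (actK p))); apply/subset_leq_card/subsetP.
move=> _ /imsetP[C + ->]; rewrite inE => /andP[fullC CA].
by rewrite inE act_full //= imset_f.
Qed.

Let perm_card A B : #|A| = #|B| -> exists p : {perm 'I_n}, p @: A = B.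
Proof.
move=> cAB; pose s D := enum D ++ enum (~: D).
have mem_s D x : x \in s D by rewrite mem_cat !mem_enum inE orbN.
have uniq_s D : uniq (s D).
  rewrite cat_uniq !enum_uniq andbT /=; apply/hasPn => x.
  by rewrite !mem_enum inE.
have size_s D : size (s D) = n by rewrite size_cat -!cardE cardsC card_ord.
pose f x := nth x (s B) (index x (s A)).
have ltf x : (index x (s A) < size (s B))%N by rewrite (size_s B) -[ltnRHS](size_s A) index_mem.
have f_inj : injective f.
  move=> x y; rewrite /f (set_nth_default x y) // => /eqP.
  rewrite nth_uniq // => /eqP Exy.
  by rewrite -(nth_index x (mem_s A x)) Exy nth_index.
exists (perm f_inj); apply/eqP; rewrite eqEcard card_imset; last exact: perm_inj.
rewrite cAB leqnn andbT; apply/subsetP => _ /imsetP[x Ax ->]; rewrite permE /f.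
have xA : x \in enum A by rewrite mem_enum.
have ltx : (index x (enum A) < #|B|)%N by rewrite -cAB cardE index_mem.
by rewrite index_cat xA nth_cat -cardE ltx -mem_enum mem_nth // -cardE.
Qed.

Let card_through A :
  (#|chains_through A| * 'C(n, #|A|) = #|full_chains n|)%N.
Proof.
have same B : #|B| = #|A| -> #|chains_through B| = #|chains_through A|.
  move=> cBA; apply/eqP; rewrite eqn_leq.
  have [p defA] := perm_card cBA; have [q defB] := perm_card (esym cBA).
  have := card_through_perm q A; rewrite defB => ->.
  by have := card_through_perm p B; rewrite defA => ->.
have leAn : (#|A| <= n)%N by rewrite -[leqRHS]card_ord max_card.
transitivity (\sum_(B : {set 'I_n} | #|B| == #|A|) #|chains_through B|)%N.
  rewrite (eq_bigr (fun=> #|chains_through A|)) => [|B /eqP/same //].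
  rewrite sum_nat_const mulnC; congr (_ * _)%N.
  by rewrite -[n in 'C(n, _)]card_ord -card_draws; apply: eq_card => B; rewrite inE.
rewrite (eq_bigr (fun B => \sum_(C in full_chains n) (B \in C : nat))%N); last first.
  by move=> B _; rewrite -sum1dep_card big_mkcondr.
rewrite exchange_big /= -[RHS]sum1_card; apply: eq_bigr => C fullC.
rewrite -(level_full fullC leAn) -sum1dep_card big_mkcond [RHS]big_mkcond.
by apply: eq_bigr => B _; rewrite andbC; case: (_ == _); case: (_ \in _).
Qed.

Lemma lubellE (R : realType) (F : {set {set 'I_n}}) :
  lubell R F = \sum_(A in F) ('C(n, #|A|)%:R)^-1.
Proof.
have full_gt0 : (0 < #|full_chains n|)%N.
  have ch0 : is_chain (set0 : {set {set 'I_n}}).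
    by apply/is_chainP => A B; rewrite inE.
  have [C maxC _] := maxset_exists ch0.
  by apply/card_gt0P; exists C; rewrite inE.
rewrite /lubell (eq_bigr (fun C => \sum_(A in F) (A \in C)%:R)); last first.
  move=> C _; rewrite -sum1_card natr_sum (eq_bigl (fun A => (A \in F) && (A \in C))).
    by rewrite big_mkcondr; apply: eq_bigr => A _; case: (A \in C).
  by move=> A; rewrite inE.
rewrite exchange_big /= mulr_suml; apply: eq_bigr => A _.
have -> : \sum_(C in full_chains n) (A \in C)%:R = #|chains_through A|%:R :> R.
  rewrite -sum1dep_card natr_sum [RHS]big_mkcondr.
  by apply: eq_bigr => C _; case: (A \in C).
have := full_gt0; rewrite -(card_through A) muln_gt0 => /andP[thr_gt0 bin_gt0'].
by rewrite natrM invfM mulrA divff ?mul1r // pnatr_eq0 -lt0n.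
Qed.

End LubellFormula.

(* [m <= #|A| <= n - m] with the subtraction taken in the integers. *)
Definition m_L_bounded (R : realType) (m : nat) (d : Order.disp_t)
    (P : finPOrderType d) : Prop :=
  forall (n : nat) (F : {set {set 'I_n}}),
    poset_free P F ->
    (forall A, A \in F -> (m <= #|A|)%N && (#|A| + m <= n)%N) ->
    lubell R F <= (e_poset P)%:R.

Definition uniformly_L_bounded (R : realType) (d : Order.disp_t)
    (P : finPOrderType d) : Prop :=
  m_L_bounded R 0 P.

Definition L_bounded (R : realType) (d : Order.disp_t)
    (P : finPOrderType d) : Prop :=
  exists m : nat, m_L_bounded R m P.

Definition lower_L_bounded (R : realType) (d : Order.disp_t)
    (P : finPOrderType d) : Prop :=
  forall beta eps : R, 2^-1 < beta < 1 -> 0 < eps ->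
  exists N : nat, forall n : nat, (N <= n)%N ->
  forall F : {set {set 'I_n}},
    poset_free P F ->
    (forall A, A \in F -> #|A|%:R < beta * n%:R) ->
    lubell R F <= (e_poset P)%:R + eps.

(* [None] is the common bottom element; [Some (Tagged _ x)] is a non-bottom
   element of the component with index [tag]. *)
Definition wedge (d : Order.disp_t) (I : finType)
    (P : I -> finBPOrderType d) : Type :=
  option {i : I & {x : P i | x != \bot%O}}.

Section WedgeOrder.
Variables (d : Order.disp_t) (I : finType) (P : I -> finBPOrderType d).

HB.instance Definition _ := Finite.on (wedge P).

Definition wedge_le (u v : wedge P) : bool :=
  match u, v with
  | None, _ => true
  | Some _, None => false
  | Some a, Some b =>
      (tag a == tag b) && (val (tagged a) <= val (tagged_as a b))%O
  end.

Let wedge_le_refl : reflexive wedge_le.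
Proof. by case=> [[i x]|] //=; rewrite eqxx tagged_asE lexx. Qed.

Let wedge_le_anti : antisymmetric wedge_le.
Proof.
case=> [[i x]|] [[j y]|] //= /andP[/andP[/eqP eqij +] /andP[_]].
case: j / eqij y => y; rewrite !tagged_asE /= => lexy leyx.
by congr (Some (Tagged _ _)); apply/val_inj/le_anti; rewrite lexy leyx.
Qed.

Let wedge_le_trans : transitive wedge_le.
Proof.
case=> [[j y]|] [[i x]|] [[k z]|] //= /andP[/eqP eqij +] /andP[/eqP eqjk].
case: k / eqjk z => z; case: j / eqij y z => y z.
by rewrite !tagged_asE eqxx /=; apply: le_trans.
Qed.

HB.instance Definition _ := Order.Le_isPOrder.Build d (wedge P)
  wedge_le_refl wedge_le_anti wedge_le_trans.

Let wedge_le0 (u : wedge P) : (None <= u :> wedge P)%O.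
Proof. by []. Qed.

HB.instance Definition _ := Order.hasBottom.Build d (wedge P) wedge_le0.

End WedgeOrder.

(* Main.v *)
(** Given [A] in a wedge-free family [F], choose greedily copies of the [P i] in
    [F], all with bottom [A] and otherwise disjoint.  The choice gets stuck at
    some [j], so that after deleting boundedly many sets other than [A], the part
    of [F] above [A] is [P j]-free (the bottom of a copy above [A] can be moved
    down to [A]).  Uniform L-boundedness in the interval [[A, [n]]] bounds its
    Lubell function there by [e (P j)], and the deleted sets, none of which is
    [A] or [[n]], contribute at most [1 / (n - #|A|)] each.  Averaging over the
    least member of [F] on a full chain gives the lower-L-bound.  If [e_1 > e_2],
    choose the copy of the first component first: either nothing has been deleted
    when the choice gets stuck, or [e (P j) <= e_1 - 1] leaves room for the
    contribution of the deleted sets. *)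

Require Import Defs.
From mathcomp Require Import all_boot all_order all_algebra.
From mathcomp Require Import reals.
From mathcomp Require Import boolp.
From mathcomp Require Import lra.

Set Implicit Arguments.
Unset Strict Implicit.
Unset Printing Implicit Defensive.

Import Order.TTheory GRing.Theory Num.Theory.
Local Open Scope ring_scope.

(** * Lubell sums over the interval from [A] to the full set *)

Lemma leq_bin_inner m j : (0 < j < m)%N -> (m <= 'C(m, j))%N.
Proof.
elim: m j => [|m IHm] [|j] //=.
rewrite ltnS => ltjm; rewrite binS.
have := ltjm; rewrite leq_eqVlt => /predU1P[<-|ltSjm].
  by rewrite binn binSn.
have leC := IHm j.+1 ltSjm.
by rewrite -addn1 leq_add // bin_gt0 ltnW.
Qed.

Section UpLubell.
Variables (R : realType) (n : nat).
Implicit Types (A B : {set 'I_n}) (F G T : {set {set 'I_n}}).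

(* The Lubell function of [F] inside the interval from [A] to [setT]. *)
Definition up_lubell A F : R :=
  \sum_(B in F | A \subset B) ('C(#|~: A|, #|B :\: A|)%:R)^-1.

Lemma up_lubell0 F : up_lubell set0 F = lubell R F.
Proof.
rewrite lubellE /up_lubell setC0 cardsT card_ord.
by apply: eq_big => [B|B _]; rewrite ?sub0set ?andbT // setD0.
Qed.

Lemma cardsC1U A x : x \notin A -> #|~: A| = #|~: (x |: A)|.+1.
Proof. by move=> xA; rewrite setCU -setDE setDE setIC -setDE (cardsD1 x) inE xA. Qed.

Lemma cardsD1U A B x : x \in B :\: A -> #|B :\: A| = #|B :\: (x |: A)|.+1.
Proof. by move=> xBA; rewrite (cardsD1 x) xBA setUC -setDDl. Qed.

(** The first element that a random full chain adds to [A] is uniform on [~: A]. Term by term: each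
    [B] in [F] above [A] is strictly above it and is reached through [#|B :\: A|] elements [x];
    [mul_bin_diag] balances the binomial coefficients. *)
Lemma up_lubell_step A F : A \notin F ->
  #|~: A|%:R * up_lubell A F = \sum_(x in ~: A) up_lubell (x |: A) F.
Proof.
move=> AF; rewrite /up_lubell mulr_sumr.
under [RHS]eq_bigr do rewrite big_mkcondr.
rewrite exchange_big /= big_mkcondr; apply: eq_bigr => B BF.
case: ifPn => sAB; last first.
  rewrite big1 // => x _; rewrite subUset; case: ifP => // /andP[_ sAB'].
  by rewrite sAB' in sAB.
rewrite -big_mkcondr.
have nBA : (0 < #|B :\: A|)%N.
  rewrite card_gt0 setD_eq0; apply: contraNN AF => sBA.
  by have /eqP-> : A == B by rewrite eqEsubset sAB.
pose c : R := ('C(#|~: A|.-1, #|B :\: A|.-1)%:R)^-1.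
rewrite (eq_big (fun x => x \in B :\: A) (fun=> c)); last first.
- move=> x; rewrite inE subUset sub1set sAB andbT => /andP[xA xB].
  by rewrite /c (cardsC1U xA) (@cardsD1U A B x) // inE xA.
- by move=> x; rewrite !inE subUset sub1set sAB andbT.
rewrite sumr_const -[RHS]mulr_natl /c.
have leBA : (#|B :\: A| <= #|~: A|)%N by rewrite subset_leq_card // setDE subsetIr.
case: #|B :\: A| nBA leBA => // b _; case: #|~: A| => // m; rewrite ltnS => lebm /=.
have C0 : 'C(m.+1, b.+1)%:R != 0 :> R by rewrite pnatr_eq0 -lt0n bin_gt0.
have C1 : 'C(m, b)%:R != 0 :> R by rewrite pnatr_eq0 -lt0n bin_gt0.
by apply/eqP; rewrite eqr_div // -!natrM mul_bin_diag.
Qed.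

(* Splitting the full chains according to their least member in [F], without
   chains: descend from [A] one element at a time until a member is met. *)
Lemma up_lubell_le_of_members F (c : R) : 0 <= c ->
  {in F, forall A, up_lubell A F <= c} -> forall A, up_lubell A F <= c.
Proof.
move=> c0 hF A; have [m] := ubnP #|~: A|; elim: m A => // m IHm A ltAm.
have [/hF//|AF] := boolP (A \in F).
have [A0|A0] := posnP #|~: A|.
  rewrite /up_lubell big1 // => B /andP[BF sAB]; case/negP: AF.
  move/eqP: A0; rewrite cards_eq0 => /eqP A0.
  suff <- : B = A by [].
  by apply/eqP; rewrite eqEsubset sAB andbT -setCS A0 sub0set.
rewrite -(@ler_pM2l _ #|~: A|%:R) ?ltr0n // up_lubell_step //.
rewrite mulr_natl -sumr_const; apply: ler_sum => x; rewrite inE => xA.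
by apply: IHm; rewrite -ltnS -(cardsC1U xA).
Qed.

(** A deleted member of [F] above [A] is neither [A] nor [setT], so its binomial coefficient is an
    inner one, hence at least [#|~: A|]. *)
Lemma up_lubell_setD F T A : setT \notin F -> A \notin T ->
  up_lubell A F <= up_lubell A (F :\: T) + #|T|%:R / #|~: A|%:R.
Proof.
move=> FT AT; rewrite /up_lubell (bigID (fun B => B \in T)) /= addrC lerD //.
  rewrite [leLHS](eq_bigl (fun B => (B \in F :\: T) && (A \subset B))) // => B.
  by rewrite inE andbC andbA.
rewrite mulr_natl -sumr_const [leRHS]big_mkcond [leLHS]big_mkcond /=; apply: ler_sum => B _.
case: ifP => [/andP[/andP[BF sAB] BT]|_]; last by case: ifP; rewrite ?invr_ge0.
have nBA : (0 < #|B :\: A|)%N.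
  rewrite card_gt0 setD_eq0; apply: contraNN AT => sBA.
  by have /eqP-> : A == B by rewrite eqEsubset sAB.
have ltBA : (#|B :\: A| < #|~: A|)%N.
  apply: proper_card; rewrite setDE setIC properE subsetIl /= subsetI subxx /=.
  apply: contraNN FT => sB; suff <- : B = setT by [].
  apply/eqP; rewrite -subTset; apply/subsetP => x _.
  by have [/(subsetP sAB)//|xA] := boolP (x \in A); apply: (subsetP sB); rewrite inE.
have C0 : (0 < #|~: A|)%N by apply: leq_ltn_trans ltBA.
rewrite BT lef_pV2 ?posrE ?ltr0n // ?ler_nat ?leq_bin_inner ?nBA //.
by rewrite bin_gt0 ltnW.
Qed.

End UpLubell.

(** The map [phi] identifies the subsets of a set of size [#|~: A|] with the interval above [A],
    preserving inclusion. The preimage [H] of [F] is thus [Q]-free, and its ordinary Lubell function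
    equals the sum above [A]. *)
Lemma up_lubell_le_e (R : realType) n d (Q : finPOrderType d) (A : {set 'I_n})
    (F : {set {set 'I_n}}) :
  uniformly_L_bounded R Q -> poset_free Q [set B in F | A \subset B] ->
  up_lubell R A F <= (e_poset Q)%:R.
Proof.
move=> ubQ freeF.
pose g (x : 'I_#|~: A|) : 'I_n := enum_val x.
have g_inj : injective g by apply: enum_val_inj.
have gA x : g x \notin A by have := enum_valP x; rewrite inE.
pose phi (X : {set 'I_#|~: A|}) := A :|: g @: X.
have phiD X : phi X :\: A = g @: X.
  rewrite /phi setDUl setDv set0U; apply/setDidPl; rewrite disjoint_subset.
  by apply/subsetP => _ /imsetP[x _ ->]; rewrite inE.
have phi_inj : injective phi.
  by move=> X Y eqXY; apply: (imset_inj g_inj); rewrite -!phiD eqXY.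
pose H := phi @^-1: F.
have freeH : poset_free Q H.
  move=> [f [f_inj fH fle]]; apply: freeF; exists (phi \o f); split.
  - exact: inj_comp.
  - by move=> u; have := fH u; rewrite !inE => -> /=; apply: subsetUl.
  - by move=> u v /fle fuv; rewrite setUS // imsetS.
suff <- : lubell R H = up_lubell R A F.
  apply: (ubQ _ _ freeH) => B _.
  by rewrite addn0 leq0n (leq_trans (max_card _)) ?card_ord.
rewrite lubellE /up_lubell.
pose psi (B : {set 'I_n}) := g @^-1: B.
have phiK (B : {set 'I_n}) : A \subset B -> phi (psi B) = B.
  move=> sAB; apply/setP => x; rewrite !inE; have [/(subsetP sAB)->//|xA /=] := boolP (x \in A).
  have xCA : x \in ~: A by rewrite inE.
  rewrite -[x in LHS](enum_rankK_in xCA xCA) (mem_imset _ _ g_inj) inE /g.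
  by rewrite enum_rankK_in.
rewrite [RHS](reindex_onto phi psi) /=; last by move=> B /andP[_ /phiK].
apply: eq_big => [X|X _]; last by rewrite phiD card_imset.
rewrite !inE subsetUl andbT; suff -> : psi (phi X) = X by rewrite eqxx andbT.
by apply: phi_inj; rewrite phiK // subsetUl.
Qed.

(** * Copies with prescribed bottom and the greedy choice of components *)

Section Rooted.
Variables (d : Order.disp_t) (n : nat).
Implicit Types (A B : {set 'I_n}) (F T : {set {set 'I_n}}).

Definition rooted_copy (Q : finBPOrderType d) F A (f : Q -> {set 'I_n}) : Prop :=
  [/\ injective f, forall u, f u \in F,
      forall u v : Q, (u <= v)%O -> f u \subset f v & f \bot%O = A].

Lemma poset_free_above (Q : finBPOrderType d) F A :
  A \in F -> ~ (exists f : Q -> {set 'I_n}, rooted_copy F A f) ->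
  poset_free Q [set B in F | A \subset B].
Proof.
move=> AF noroot [f [f_inj fF fle]]; apply: noroot.
have fFu u : f u \in F by have := fF u; rewrite inE => /andP[].
have fA u : A \subset f u by have := fF u; rewrite inE => /andP[].
(* The image of the bottom lies between [A] and [f u], so [f u = A] would make the two images equal.
   Hence moving the bottom to [A] keeps the map injective. *)
have fnA u : u != \bot%O -> f u <> A.
  move=> u0 fuA; case/eqP: u0; apply: f_inj; apply/eqP.
  by rewrite eqEsubset {1}fuA fA fle // le0x.
exists (fun u => if u == \bot%O then A else f u); split.
- move=> u v /=; case: eqVneq => [->|u0]; case: eqVneq => [->|v0] //.
  + by move/esym/(fnA _ v0).
  + by move/(fnA _ u0).
  + exact: f_inj.
- by move=> u; case: ifP.
- move=> u v leuv; case: eqVneq => [_|u0]; first by case: ifP.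
  case: eqVneq => [v0|_]; last exact: fle.
  by case/eqP: u0; apply: le_anti; rewrite le0x -v0 leuv.
- by rewrite eqxx.
Qed.

Variables (I : finType) (P : I -> finBPOrderType d).

Lemma contains_wedge F A (f : forall i, P i -> {set 'I_n}) :
  A \in F -> (forall i, rooted_copy F A (f i)) ->
  (forall i j, i != j -> forall x y, f i x = f j y -> f i x = A) ->
  contains_poset (wedge P) F.
Proof.
move=> AF fP fdisj.
have fnA i (x : {x : P i | x != \bot%O}) : f i (val x) <> A.
  have [f_inj _ _ <-] := fP i.
  by move=> /f_inj; apply/eqP; apply: (valP x).
exists (fun u : wedge P => if u is Some (existT i x) then f i (val x) else A).
split.
- case=> [[i x]|] [[j y]|] //=; first last.
  + by move=> /esym/fnA.
  + by move=> /fnA.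
  have [eqij|neij] := eqVneq i j; last by move=> /(fdisj _ _ neij)/fnA.
  case: j / eqij y => y; have [f_inj _ _ _] := fP i.
  by move=> /f_inj/val_inj->.
- by case=> [[i x]|] //=; have [] := fP i.
- case=> [[i x]|] [[j y]|] //=.
  + move=> /andP[/= /eqP eqij]; case: j / eqij y => y; rewrite tagged_asE.
    by have [_ _ + _] := fP i; apply.
  + by move=> _; have [_ _ fle <-] := fP j; apply: fle; apply: le0x.
Qed.

(* Copies of the components are chosen greedily, [i0] first; [T] collects the
   sets used up when the choice gets stuck at the component [j]. *)
Lemma wedge_free_stuck (i0 : I) F A : poset_free (wedge P) F -> A \in F ->
  exists j T, [/\ A \notin T, (#|T| <= \sum_i #|P i|)%N, j = i0 -> T = set0 &
    ~ (exists f : P j -> {set 'I_n}, rooted_copy (F :\: T) A f)].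
Proof.
move=> freeF AF; apply: contrapT => stuck.
have grow j T : A \notin T -> (#|T| <= \sum_i #|P i|)%N -> (j = i0 -> T = set0) ->
    exists f : P j -> {set 'I_n}, rooted_copy (F :\: T) A f.
  by move=> AT cT j0; apply: contrapT => nof; apply: stuck; exists j, T; split.
(* Induction on the components already served; keeping [i0] at the head means that its copy is
   chosen before anything is deleted. *)
have chosen (s : seq I) : exists f : forall i, P i -> {set 'I_n},
    {in i0 :: s, forall i, rooted_copy F A (f i)} /\
    {in i0 :: s &, forall i j, i != j ->
       forall x y, f i x = f j y -> f i x = A}.
  elim: s => [|j s [f [fP fdisj]]].
    have A0 : A \notin set0 by rewrite inE.
    have [|//|g gP] := grow i0 set0 A0; first by rewrite cards0.
    rewrite setD0 in gP.
    (* The constant [A] is a placeholder for the components not yet served. *)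
    exists (dfwith (fun i (_ : P i) => A) g); split.
      by move=> i; rewrite inE => /eqP->; rewrite dfwith_in.
    by move=> i j; rewrite !inE => /eqP-> /eqP->; rewrite eqxx.
  have memS i : i \in i0 :: j :: s -> i = j \/ i \in i0 :: s.
    by rewrite !inE => /or3P[->|/eqP->|->]; rewrite ?orbT; [right|left|right].
  have [js|js] := boolP (j \in i0 :: s).
    have sub i : i \in i0 :: j :: s -> i \in i0 :: s by case/memS => [->|].
    exists f; split=> [i /sub/fP//|i1 i2 /sub i1s /sub i2s].
    exact: fdisj.
  have ji0 : j <> i0 by move=> eqj; rewrite eqj mem_head in js.
  (* The union over all components, served or not, gives the size bound at once; [A] is kept
     available as the bottom of the next copy. *)
  pose T := (\bigcup_i f i @: [set: P i]) :\ A.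
  have cT : (#|T| <= \sum_i #|P i|)%N.
    apply: leq_trans (subset_leq_card (subsetDl _ _)) _.
    elim/big_ind2: _ => [|m1 B1 m2 B2 le1 le2|i _]; first by rewrite cards0.
      by apply: leq_trans (leq_card_setU _ _) _; apply: leq_add.
    by rewrite -cardsT leq_imset_card.
  have AT : A \notin T by rewrite !inE eqxx.
  have [/ji0//|g gP] := grow j T AT cT.
  have gdisj i x y : f i x = g y -> f i x = A.
    move=> eqfg; apply/eqP; have [_ /(_ y) + _ _] := gP.
    rewrite -eqfg !inE => /andP[+ _]; rewrite negb_and negbK.
    by case/orP=> // /bigcupP[]; exists i => //; apply: imset_f.
  have gF : rooted_copy F A g.
    have [g_inj gFT gle gA] := gP; split=> // u.
    by have := gFT u; rewrite inE => /andP[].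
  exists (dfwith f g); split=> [i|i1 i2].
    case/memS => [->|iS]; first by rewrite dfwith_in.
    rewrite dfwith_out; first exact: fP.
    by apply: contraNneq js => ->.
  have old i : i \in i0 :: s -> dfwith f g i = f i.
    by move=> iS; rewrite dfwith_out //; apply: contraNneq js => ->.
  case/memS => [eq1|i1S] /memS[eq2|i2S].
  - by rewrite eq1 eq2 eqxx.
  - move=> _; rewrite eq1 dfwith_in old // => x y eqfg.
    by rewrite eqfg; apply: gdisj (esym eqfg).
  - move=> _; rewrite eq2 dfwith_in old // => x y.
    exact: gdisj.
  - by rewrite !old //; apply: fdisj.
have [f [fP fdisj]] := chosen (enum I).
have inI i : i \in i0 :: enum I by rewrite inE mem_enum orbT.
by apply/freeF/(contains_wedge AF (f := f)) => [i|i j]; [apply: fP | apply: fdisj].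
Qed.
End Rooted.

(** * Comparison of the wedge with its components, and the final estimates *)

Lemma e_poset_wedge d (I : finType) (P : I -> finBPOrderType d) i :
  (e_poset (P i) <= e_poset (wedge P))%N.
Proof.
have Pi_gt0 : (0 < #|P i|)%N by apply/card_gt0P; exists \bot%O.
have [freeP _] := e_posetP Pi_gt0.
have [|_] := @e_posetP _ (wedge P); first by apply/card_gt0P; exists None.
apply=> n s [f [f_inj fF fle]]; apply: (freeP n s).
(* [insub x] is [None] exactly at the bottom, so [h] embeds [P i] in the wedge. *)
pose h (x : P i) : wedge P :=
  omap (Tagged (fun j => {y : P j | y != \bot%O})) (insub x).
exists (f \o h); split=> [|u|u v leuv]; last 2 first.
- exact: fF.
- apply: fle; rewrite /h; case: insubP => [a _ defa|//]; case: insubP => [b _ defb|v0].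
    by apply/andP; rewrite /= tagged_asE defa defb.
  have := valP a; rewrite /= defa; case/eqP.
  by apply: le_anti; rewrite le0x -(eqP (negbNE v0)) leuv.
apply: inj_comp => // u v; rewrite /h.
case: insubP => [a _ <-|/negbNE/eqP->]; case: insubP => [b _ <-|/negbNE/eqP->] //=.
by case=> /eqP; rewrite eq_Tagged /= => /eqP->.
Qed.

(** The two cases are whether the choice gets stuck at [i0]; if so, nothing was deleted and there is
    no error term. *)
Lemma up_lubell_wedge_free (R : realType) d (I : finType)
    (P : I -> finBPOrderType d) (i0 : I) n (A : {set 'I_n}) (F : {set {set 'I_n}}) :
  (forall i, uniformly_L_bounded R (P i)) ->
  poset_free (wedge P) F -> setT \notin F -> A \in F ->
  up_lubell R A F <= (e_poset (P i0))%:R \/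
  exists2 j, j != i0 & up_lubell R A F <=
    (e_poset (P j))%:R + (\sum_i #|P i|)%N%:R / #|~: A|%:R.
Proof.
move=> hP freeF FT AF.
have [j [T [AT cT j0 /(poset_free_above _)]]] := wedge_free_stuck i0 freeF AF.
move=> /(_ _)/(up_lubell_le_e (hP j)); rewrite inE AT AF => /(_ isT) leT.
have [eqj|nej] := eqVneq j i0.
  by left; move: leT; rewrite j0 // setD0 eqj.
right; exists j => //; apply: le_trans (up_lubell_setD _ FT AT) _.
by rewrite lerD // ler_wpM2r ?invr_ge0 // ler_nat.
Qed.

Theorem theorem6p4 (R : realType) (d : Order.disp_t) (k : nat)
    (hk : (2 <= k)%N) (P : 'I_k -> finBPOrderType d)
    (hP : forall i : 'I_k, uniformly_L_bounded R (P i))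
    (he : forall i j : 'I_k, (i <= j)%N -> (e_poset (P j) <= e_poset (P i))%N) :
  lower_L_bounded R (wedge P) /\
  ((e_poset (P (Ordinal hk)) < e_poset (P (Ordinal (ltnW hk))))%N ->
   L_bounded R (wedge P)).
Proof.
set i1 := Ordinal hk; set i0 := Ordinal (ltnW hk).
pose N := (\sum_i #|P i|)%N.
have e0W : (e_poset (P i0))%:R <= (e_poset (wedge P))%:R :> R.
  by rewrite ler_nat e_poset_wedge.
split=> [beta eps /andP[_ beta1] eps0|e01].
- have b0 : 0 < (1 - beta) * eps by rewrite mulr_gt0 // subr_gt0.
  (* Members of [F] miss more than [(1 - beta) * n] elements, so this threshold makes the error
     [N / #|~: A|] at most [eps]. *)
  exists (Num.bound (N%:R / ((1 - beta) * eps))) => n leNn F freeF smallF.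
  have FT : setT \notin F.
    apply/negP => /smallF; rewrite cardsT card_ord ltNge; case/negP.
    by rewrite ler_piMl // ltW.
  rewrite -up_lubell0; apply: up_lubell_le_of_members => [|A AF].
    by rewrite addr_ge0 // ltW.
  have ltN : N%:R < n%:R * ((1 - beta) * eps).
    rewrite -ltr_pdivrMr //; apply: lt_le_trans (archi_boundP _) _.
      by rewrite divr_ge0 // ltW.
    by rewrite ler_nat.
  have cA : n%:R * (1 - beta) < #|~: A|%:R.
    have := smallF A AF; have : #|A|%:R + #|~: A|%:R = n%:R :> R.
      by rewrite -natrD cardsC card_ord.
    move=> <-; lra.
  have cA0 : 0 < #|~: A|%:R :> R.
    by apply: le_lt_trans cA; rewrite mulr_ge0 // subr_ge0 ltW.
  have NA : N%:R / #|~: A|%:R <= eps.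
    rewrite ler_pdivrMr // mulrC; apply: le_trans (ltW ltN) _.
    by rewrite mulrA ler_pM2r // ltW.
  have [le0|[j _ lej]] := up_lubell_wedge_free i0 hP freeF FT AF.
    by apply: le_trans le0 _; rewrite -[leLHS]addr0 lerD // ltW.
  apply: le_trans lej _; rewrite lerD //; apply: le_trans e0W.
  by rewrite ler_nat he.
(* Each member then misses more than [N] elements: [setT] is excluded and the error is at most 1. *)
- exists N.+1 => n F freeF sizeF.
  have FT : setT \notin F.
    by apply/negP => /sizeF/andP[_]; rewrite cardsT card_ord addnS ltnNge leq_addr.
  rewrite -up_lubell0; apply: up_lubell_le_of_members => // A AF.
  apply: le_trans e0W.
  have [//|[j nej lej]] := up_lubell_wedge_free i0 hP freeF FT AF.
  apply: le_trans lej _.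
  have cA : (N < #|~: A|)%N.
    have /andP[_ leA] := sizeF A AF.
    by rewrite -(leq_add2l #|A|) cardsC card_ord.
  have NA : N%:R / #|~: A|%:R <= 1 :> R.
    by rewrite ler_pdivrMr ?ltr0n ?(leq_trans _ cA) // mul1r ler_nat ltnW.
  (* The strict drop from [i0] to [i1] absorbs this 1, since [j != i0] puts [j] at [i1] or later. *)
  apply: (le_trans (lerD (lexx _) NA)); rewrite natr1 ler_nat.
  apply: leq_ltn_trans e01; apply: he.
  by rewrite lt0n; apply: contraNneq nej => j0; apply/eqP/val_inj.
Qed.
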